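(* Let $G$ be a Lie group acting effectively by isometries on a connected Riemannian manifold $(M,g)$, and let $\mathfrak{g}$ be the Lie algebra of $G$, identified with a Lie algebra of Killing vector fields on $(M,g)$. Then for any Killing vector field of constant length $X\in\mathfrak{g}$ on $(M,g)$, the spectrum of the operator $\operatorname{ad}(X):\mathfrak{g}\to\mathfrak{g}$ is pure imaginary, i.e. is contained in $\mathbf{i}\mathbb{R}$, where $\mathbf{i}=\sqrt{-1}$.
   Context: Each $U\in\mathfrak{g}$ is identified with the Killing vector field $\widetilde U$ on $M$ given by $\widetilde{U}(x)=\frac{d}{dt}\exp(tU)(x)\big|_{t=0}$. The map $U\mapsto\widetilde U$ is linear and injective, and $[\widetilde U,\widetilde V]=-\widetilde{[U,V]_{\mathfrak g}}$, where $[\cdot,\cdot]_{\mathfrak g}$ is the Lie bracket of $\mathfrak g$ and $[\cdot,\cdot]$ is the Lie bracket of vector fields; under the identification, $[\cdot,\cdot]$ denotes the bracket of vector fields and $\operatorname{ad}(X)(Y)=[X,Y]$. $X$ has constant length on $(M,g)$ if the function $x\mapsto g_x(X(x),X(x))$ is constant on $M$. The spectrum of a linear operator on the real finite-dimensional space $\mathfrak g$ means the set of its complex eigenvalues (eigenvalues of its complexification); $0$ counts as an element of $\mathbf{i}\mathbb{R}$. *)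

(* Defs.v *)
From HB Require Import structures.
From mathcomp Require Import all_boot all_order all_algebra.
From mathcomp Require Import all_classical all_reals all_analysis.
From mathcomp Require Import complex.

Set Implicit Arguments.
Unset Strict Implicit.
Unset Printing Implicit Defensive.

Import Order.TTheory GRing.Theory Num.Theory.
Import numFieldNormedType.Exports.

Local Open Scope classical_set_scope.
Local Open Scope ring_scope.

(* [C_on k U f]: f is k times continuously differentiable on the open set U. *)
Fixpoint C_on (R : realType) (V W : normedModType R) (k : nat) (U : set V)
    (f : V -> W) : Prop :=
  match k with
  | 0 => forall x, U x -> {for x, continuous f}
  | k'.+1 => (forall x, U x -> differentiable f x) /\
             (forall v, C_on k' U (fun x => 'd f x v))
  end.

Definition smooth_on (R : realType) (V W : normedModType R) (U : set V)
    (f : V -> W) : Prop :=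
  forall k, C_on k U f.

(* [cinv] is the inverse of [cmap : cdom -> cimg]; both functions take
   arbitrary values outside their domains. *)
Record chart (R : realType) (n : nat) (T : Type) := Chart {
  cdom : set T;
  cmap : T -> 'rV[R]_n;
  cinv : 'rV[R]_n -> T }.

Definition cimg (R : realType) n (T : Type) (c : chart R n T) :
    set 'rV[R]_n :=
  cmap c @` cdom c.

Definition is_chart (R : realType) n (T : topologicalType) (c : chart R n T) :
    Prop :=
  [/\ open (cdom c), open (cimg c),
      forall x, cdom c x -> cinv c (cmap c x) = x,
      forall x, cdom c x -> {for x, continuous (cmap c)}
    & forall z, cimg c z -> {for z, continuous (cinv c)}].

(* An atlas is indexed by the points of T, [A x] being a chart around x. Every
   smooth structure is given by such an atlas. Thanks to this indexing the
   tangent space at x is the type 'rV[R]_n: a tangent vector at x is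
   represented by its components in the chart [A x], and a vector field is a
   function T -> 'rV[R]_n. *)
Definition atlas (R : realType) (n : nat) (T : Type) := T -> chart R n T.

Definition smooth_manifold (R : realType) n (T : topologicalType)
    (A : atlas R n T) : Prop :=
  [/\ hausdorff_space T, @second_countable T,
      forall x, is_chart (A x) /\ cdom (A x) x
    & forall p q, smooth_on (cimg (A p) `&` cinv (A p) @^-1` cdom (A q))
                            (cmap (A q) \o cinv (A p))].

Definition prod_atlas (R : realType) m n (S T : Type) (A : atlas R m S)
    (B : atlas R n T) : atlas R (m + n) (S * T) :=
  fun p => Chart (cdom (A p.1) `*` cdom (B p.2))
    (fun q => row_mx (cmap (A p.1) q.1) (cmap (B p.2) q.2))
    (fun z => (cinv (A p.1) (lsubmx z), cinv (B p.2) (rsubmx z))).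

Definition line_atlas (R : realType) : atlas R 1 R :=
  fun _ => Chart [set: R] (fun t => const_mx t) (fun z => z ord0 ord0).

Section SmoothMaps.
Variables (R : realType) (m n : nat) (S T : topologicalType).
Variables (A : atlas R m S) (B : atlas R n T).

Definition smooth_map (f : S -> T) : Prop :=
  continuous f /\
  forall p q, smooth_on
    (cimg (A p) `&` (f \o cinv (A p)) @^-1` cdom (B q))
    (cmap (B q) \o f \o cinv (A p)).

Definition dmap (f : S -> T) (x : S) : 'rV[R]_m -> 'rV[R]_n :=
  'd (cmap (B (f x)) \o f \o cinv (A x)) (cmap (A x) x).

Definition velocity (c : R -> T) (t : R) : 'rV[R]_n :=
  derive1 (cmap (B (c t)) \o c) t.

End SmoothMaps.

Section RiemannianManifolds.
Variables (R : realType) (n : nat) (M : topologicalType) (A : atlas R n M).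

(* From the components of a tangent vector at x in the chart [A p] to its
   components in the chart [A q]. *)
Definition change_chart (p q x : M) : 'rV[R]_n -> 'rV[R]_n :=
  'd (cmap (A q) \o cinv (A p)) (cmap (A p) x).

(* [g x] is the Gram matrix of the metric at x in the chart [A x]. *)
Definition inner (g : M -> 'M[R]_n) (x : M) (u v : 'rV[R]_n) : R :=
  (u *m g x *m v^T) ord0 ord0.

Definition riemannian_metric (g : M -> 'M[R]_n) : Prop :=
  [/\ forall x u v, inner g x u v = inner g x v u,
      forall x v, v != 0 -> 0 < inner g x v v
    & forall p u v, smooth_on (cimg (A p))
        (fun z => let x := cinv (A p) z in
           inner g x (change_chart p x x u) (change_chart p x x v))].

(* This makes f an isometry whenever f is a diffeomorphism, as is every element
   of a group acting smoothly. *)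
Definition preserves_metric (g : M -> 'M[R]_n) (f : M -> M) : Prop :=
  forall x u v,
    inner g (f x) (dmap A A f x u) (dmap A A f x v) = inner g x u v.

Definition constant_length (g : M -> 'M[R]_n) (X : M -> 'rV[R]_n) : Prop :=
  exists c : R, forall x, inner g x (X x) (X x) = c.

(* The expression of the vector field X in the chart [A p]. *)
Definition local_rep (X : M -> 'rV[R]_n) (p : M) (z : 'rV[R]_n) : 'rV[R]_n :=
  let x := cinv (A p) z in change_chart x p x (X x).

(* [X, Y]^i = X^j d_j Y^i - Y^j d_j X^i, computed at p in the chart [A p]. *)
Definition lie_bracket (X Y : M -> 'rV[R]_n) : M -> 'rV[R]_n :=
  fun p => 'd (local_rep Y p) (cmap (A p) p) (X p)
           - 'd (local_rep X p) (cmap (A p) p) (Y p).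

End RiemannianManifolds.

(* Only the two structures are joined here; compatibility is part of
   [lie_group]. *)
#[short(type="groupTopologicalType")]
HB.structure Definition GroupTopological := {G of Group G & Topological G}.

Section LieGroups.
Variables (R : realType) (m : nat) (G : groupTopologicalType).
Variable (AG : atlas R m G).

Definition lie_group : Prop :=
  [/\ smooth_manifold AG,
      smooth_map (prod_atlas AG AG) AG (fun p : G * G => (p.1 * p.2)%g)
    & smooth_map AG AG (fun h : G => (h^-1)%g)].

Definition one_parameter_subgroup (gamma : R -> G) : Prop :=
  smooth_map (@line_atlas R) AG gamma /\
  forall s t, gamma (s + t) = (gamma s * gamma t)%g.

(* The Lie algebra of G is the tangent space 'rV[R]_m at the identity, and
   [exp_curve U] is the curve t |-> exp(tU), i.e. the one-parameter subgroup
   with initial velocity U (which exists and is unique in a Lie group; the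
   constant curve is only a default value for [xget]). *)
Definition exp_curve (U : 'rV[R]_m) : R -> G :=
  xget (fun=> 1%g)
    [set gamma | one_parameter_subgroup gamma /\ velocity AG gamma 0 = U].

Variables (n : nat) (M : topologicalType) (AM : atlas R n M).
Variable (act : G -> M -> M).

Definition smooth_action : Prop :=
  [/\ smooth_map (prod_atlas AG AM) AM (fun p : G * M => act p.1 p.2),
      forall x, act 1%g x = x
    & forall h k x, act (h * k)%g x = act h (act k x)].

Definition effective : Prop :=
  forall h, (forall x, act h x = x) -> h = 1%g.

Definition fundamental_field (U : 'rV[R]_m) : M -> 'rV[R]_n :=
  fun x => velocity AM (fun t => act (exp_curve U t) x) 0.

(* The Lie algebra of G, identified with a Lie algebra of vector fields on M
   by means of the linear injective map [fundamental_field]. *)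
Definition killing_algebra : set (M -> 'rV[R]_n) := range fundamental_field.

End LieGroups.

Section Spectrum.
Variables (R : realType) (V : lmodType R).

(* The pair (u, v) stands for u + iv in the complexification of V. *)
Definition cscale (z : R[i]) (w : V * V) : V * V :=
  (complex.Re z *: w.1 - complex.Im z *: w.2,
   complex.Re z *: w.2 + complex.Im z *: w.1).

Definition complexified_map (f : V -> V) (w : V * V) : V * V :=
  (f w.1, f w.2).

(* The complex eigenvalues of f on the real subspace E of V. *)
Definition spectrum (E : set V) (f : V -> V) : set R[i] :=
  [set z | exists w : V * V,
     [/\ E w.1, E w.2, w <> 0 & complexified_map f w = cscale z w]].

End Spectrum.

(* Main.v *)
(** Let Z, Y, W be fields of the algebra such that g(Y, W) is constant on M.
    The flow of Z acts by isometries, hence the pullbacks Y_t, W_t of Y, W to a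
    point p satisfy g_p(Y_t, W_t) = g(Y, W) for all t; differentiating at t = 0
    gives g([Z, Y], W) + g(Y, [Z, W]) = 0.
    Now let X have constant length and [X, U] = a U - b V, [X, V] = b U + a V.
    With Y = W = X and Z = U, V this gives g([X, U], X) = g([X, V], X) = 0, a
    linear system in g(U, X), g(V, X) of determinant a^2 + b^2; so if a <> 0,
    then g(U, X) = g(V, X) = 0 on M. With (Z, Y, W) = (U, U, X) and (V, V, X),
    where [Z, Y] = 0, we get g(U, [X, U]) = g(V, [X, V]) = 0, whose sum reads
    a (|U|^2 + |V|^2) = 0, so that U = V = 0. *)

From HB Require Import structures.
Require Import Defs.
From mathcomp Require Import all_boot all_order all_algebra.
From mathcomp Require Import all_classical all_reals all_analysis.
From mathcomp Require Import complex.
From mathcomp Require Import ring.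

Set Implicit Arguments.
Unset Strict Implicit.
Unset Printing Implicit Defensive.

Import Order.TTheory GRing.Theory Num.Theory.
Import numFieldNormedType.Exports.

Local Open Scope classical_set_scope.
Local Open Scope ring_scope.

(** * Locality of the differential, chain rule, linear maps *)

(** The difference g - f vanishes near x, hence is negligible there and has differential 0; adding
    it to f gives g. Expressions in charts agree only on chart domains, so identities between them
    are differentiated through this lemma. *)
Lemma near_is_diff (R : realType) (V W : normedModType R) (f g : V -> W)
    (x : V) :
  {near x, f =1 g} -> differentiable f x -> is_diff x g ('d f x).
Proof.
move=> fg df.
have h0 : is_diff x (g - f) 0.
  have e0 : (g - f) \o shift x = cst ((g - f) x) + 0 +o_ 0 id.
    apply/eqaddoP => _/posnumP[e].
    move: (fg); rewrite (near_shift 0) /= subr0 => fg0.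
    near=> y.
    rewrite [leLHS](_ : _ = 0) ?mulr_ge0//.
    apply/eqP; rewrite normr_eq0; apply/eqP.
    rewrite !fctE /= (nbhs_singleton fg).
    have -> : f (y + x) = g (y + x) by near: y.
    by rewrite !subrr addr0 subrr.
  have d0 : 'd (g - f) x = \0 :> (V -> W).
    by apply: diff_unique => //; exact: cst_continuous.
  apply: DiffDef => //; apply/diff_locallyP; rewrite d0; split => //.
  exact: cst_continuous.
have -> : g = f + (g - f) by apply/funext => y; rewrite !fctE addrC subrK.
have := is_diffD (differentiableP df) h0.
by rewrite addr0.
Unshelve. all: by end_near. Qed.

Lemma is_derive1_comp (R : realType) (V W : normedModType R) (c : R -> V)
    (F : V -> W) (t : R) (dc : V) :
  is_derive t 1 c dc -> differentiable F (c t) ->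
  is_derive t 1 (F \o c) ('d F (c t) dc).
Proof.
move=> [/derivable1_diffP dct dcE] dF.
have dFc : differentiable (F \o c) t by exact: differentiable_comp.
apply: DeriveDef; first exact/derivable1_diffP.
by rewrite deriveE// diff_comp//= -dcE deriveE.
Qed.

Lemma rV_linear_continuous (R : realType) n (W : normedModType R)
    (f : {linear 'rV[R]_n -> W}) : continuous f.
Proof.
have -> : (f : 'rV[R]_n -> W) =
    fun v => \sum_(i < n) v ord0 i *: f (delta_mx 0 i).
  apply/funext => v; rewrite {1}[v]row_sum_delta linear_sum.
  by apply: eq_bigr => i _; rewrite linearZ.
apply: (continuous_big (op := +%R)) => [|i _ v]; first exact: add_continuous.
apply/differentiable_continuous/differentiableZl; exact: differentiable_coord.
Qed.

Lemma is_diff_rV_linear (R : realType) n (W : normedModType R)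
    (f : {linear 'rV[R]_n -> W}) x : is_diff x f f.
Proof.
apply: DiffDef; first exact/linear_differentiable/rV_linear_continuous.
by rewrite diff_lin//; exact: rV_linear_continuous.
Qed.

Lemma is_derive_line (R : realType) (V : normedModType R) (v p : V) (s : R) :
  is_derive s 1 (fun s => s *: v + p) v.
Proof.
have d : is_diff s (fun s : R => s *: v + p) (fun s => s *: v).
  have := is_diffD (is_diff_scalel s v) (is_diff_cst p s).
  by rewrite addr0.
apply: DeriveDef; first by apply/derivable1_diffP; exact: ex_diff.
by rewrite deriveE ?diff_val ?scale1r//; exact: ex_diff.
Qed.

(** * Symmetry of second derivatives *)

(* Mean value theorem for s |-> f (s v + h w + x) - f (s v + x). *)
Lemma second_difference (R : realType) (V : normedModType R) (f : V -> R)
    (x v w : V) :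
  (\forall y \near x, differentiable f y) ->
  differentiable (fun y => 'd f y v) x ->
  forall e, 0 < e -> \forall h \near 0^'+,
    `|f (h *: v + (h *: w + x)) - f (h *: v + x) - f (h *: w + x) + f x
      - h ^+ 2 * 'd (fun y => 'd f y v) x w| <= e * h ^+ 2.
Proof.
set Q := fun y => 'd f y v; move=> df dQ e e0.
(* For s and a in [0, h], the vector s v + a w has norm at most h N; the summand 1 makes N positive.
   Two remainders of [Q], each at most eps h N = e h / 2, and the factor h from the mean value
   theorem then add up to e h^2. *)
pose N := `|v| + `|w| + 1.
have N0 : 0 < N by rewrite ltr_wpDl// addr_ge0.
pose eps := e / (2 * N).
have eps0 : 0 < eps by rewrite divr_gt0// mulr_gt0.
have Qo : \forall k \near (0 : V),
    `|Q (k + x) - Q x - 'd Q x k| <= eps * `|k|.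
  have := diff_locally dQ => /eqaddoP /(_ _ eps0).
  apply: filterS => k; rewrite !fctE /= => le_k.
  by apply: le_trans le_k; rewrite opprD addrA.
have fd : \forall k \near (0 : V), differentiable f (k + x).
  by move: df; rewrite (near_shift 0) /= subr0.
have [r /= r0 Hr] : exists2 r, 0 < r & forall k : V, `|k| < r ->
    differentiable f (k + x) /\ `|Q (k + x) - Q x - 'd Q x k| <= eps * `|k|.
  have [r /= r0 rP] := (nbhs_ballP _ _).1 (filterI fd Qo).
  exists r => // k kr; apply: rP.
  by rewrite -ball_normE /= sub0r normrN.
near=> h.
have h0 : 0 < h by near: h; exact: nbhs_right_gt.
have hr : h * N < r.
  rewrite -ltr_pdivlMr//; near: h; apply: nbhs_right_lt.
  by rewrite divr_gt0.
have kN s (a : R) : 0 <= s <= h -> 0 <= a <= h -> `|s *: v + a *: w| <= h * N.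
  move=> /andP[s0 sh] /andP[a0 ah]; apply: le_trans (ler_normD _ _) _.
  rewrite !normrZ (ger0_norm s0) (ger0_norm a0) /N !mulrDr.
  by apply: ler_wpDr; rewrite ?mulr1 ?(ltW h0)//; apply: lerD; exact: ler_wpM2r.
have H s (a : R) : 0 <= s <= h -> 0 <= a <= h ->
    differentiable f (s *: v + a *: w + x) /\
    `|Q (s *: v + a *: w + x) - Q x - 'd Q x (s *: v + a *: w)|
      <= eps * (h * N).
  move=> sh ah; have := kN _ _ sh ah => le.
  have [d q] := Hr _ (le_lt_trans le hr); split=> //.
  by apply: le_trans q _; rewrite ler_pM2l.
pose g s := f (s *: v + (h *: w + x)) - f (s *: v + x).
have hh : 0 <= h <= h by rewrite lexx ltW.
have h00 : 0 <= (0 : R) <= h by rewrite lexx ltW.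
have dg s : 0 <= s <= h ->
    is_derive s 1 g (Q (s *: v + (h *: w + x)) - Q (s *: v + x)).
  move=> sh; apply: is_deriveB.
    apply: (is_derive1_comp (is_derive_line v _ s)).
    by rewrite addrA; have [] := H _ _ sh hh.
  apply: (is_derive1_comp (is_derive_line v _ s)).
  by have [] := H _ _ sh h00; rewrite scale0r addr0.
have [xi xih gE] : exists2 xi, 0 <= xi <= h &
    g h - g 0 = (Q (xi *: v + (h *: w + x)) - Q (xi *: v + x)) * h.
  have dg' s : s \in `]0, h[ ->
      is_derive s 1 g (Q (s *: v + (h *: w + x)) - Q (s *: v + x)).
    by rewrite in_itv /= => /andP[s0 sh]; apply: dg; rewrite !ltW.
  have cg : {within `[0, h], continuous g}.
    apply: derivable_within_continuous => s; rewrite in_itv /= => sh.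
    by have [] := dg _ sh.
  have [xi] := MVT_segment (ltW h0) dg' cg.
  by rewrite in_itv /= subr0; exists xi.
have [_ q1] := H _ _ xih hh; have [_ q2] := H _ _ xih h00.
have -> : f (h *: v + (h *: w + x)) - f (h *: v + x) - f (h *: w + x) + f x =
    g h - g 0.
  by rewrite /g !scale0r !add0r; ring.
have dE a : 'd Q x (xi *: v + a *: w) = xi * 'd Q x v + a * 'd Q x w.
  by rewrite linearD !linearZ.
move: q1 q2; rewrite gE !dE scale0r addr0 mul0r addr0 -(addrA (xi *: v) _ x).
move: (Q (_ + (_ + _))) (Q (_ + x)) (Q x) ('d Q x v) ('d Q x w).
move=> a b q c d q1 q2.
(* The first-order terms xi c along v cancel between the two expansions of [Q] at x, which leaves h
   d and the two remainders. *)
have -> : (a - b) * h - h ^+ 2 * d =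
    h * ((a - q - (xi * c + h * d)) - (b - q - xi * c)) by ring.
rewrite normrM (ger0_norm (ltW h0)) expr2 mulrCA ler_pM2l//.
apply: le_trans (ler_normB _ _) (le_trans (lerD q1 q2) _).
rewrite le_eqVlt /eps; apply/orP; left; apply/eqP; field.
by rewrite gt_eqF.
Unshelve. all: by end_near. Qed.

(** The second difference of f is symmetric in v and w, so for a common small h it is within (e / 2)
    h^2 of both mixed derivatives times h^2. *)
Lemma schwarz_scalar (R : realType) (V : normedModType R) (f : V -> R)
    (x v w : V) :
  (\forall y \near x, differentiable f y) ->
  differentiable (fun y => 'd f y v) x ->
  differentiable (fun y => 'd f y w) x ->
  'd (fun y => 'd f y v) x w = 'd (fun y => 'd f y w) x v.
Proof.
move=> df dv dw; apply/eqP; rewrite -subr_eq0 -normr_le0; apply/ler_addgt0Pr.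
move=> e e0; rewrite add0r.
have e20 : 0 < e / 2 by rewrite divr_gt0.
have F1 := @second_difference _ _ _ _ _ w df dv _ e20.
have F2 := @second_difference _ _ _ _ _ v df dw _ e20.
have [h [[D1 D2] h0]] := filter_ex (filterI (filterI F1 F2) (nbhs_right_gt 0)).
move: D1 D2; rewrite addrCA.
set A := f _; set B := f _; set C := f _; set D := f x.
set a := 'd _ x w; set b := 'd _ x v => D1 D2.
have h20 : 0 < h ^+ 2 by rewrite exprn_gt0.
rewrite -(ler_pM2r h20) -[X in _ * X <= _](ger0_norm (ltW h20)) -normrM.
have -> : (a - b) * h ^+ 2 =
  (A - C - B + D - h ^+ 2 * b) - (A - B - C + D - h ^+ 2 * a) by ring.
apply: le_trans (ler_normB _ _) (le_trans (lerD D2 D1) _).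
by rewrite -mulrDl -splitr.
Qed.

(** Reduction to one coordinate at a time. Taking a coordinate commutes with differentiating f only
    where f is differentiable, that is near x, hence the use of [near_is_diff]. *)
Lemma schwarz (R : realType) (V : normedModType R) n (f : V -> 'rV[R]_n)
    (x v w : V) :
  (\forall y \near x, differentiable f y) ->
  differentiable (fun y => 'd f y v) x ->
  differentiable (fun y => 'd f y w) x ->
  'd (fun y => 'd f y v) x w = 'd (fun y => 'd f y w) x v.
Proof.
move=> df dv dw; apply/rowP => i.
pose p (u : 'rV[R]_n) : R := u ord0 i.
have coordE (F : V -> 'rV[R]_n) y k : differentiable F y ->
    'd F y k ord0 i = 'd (p \o F) y k.
  move=> dF; rewrite -!deriveE//; last first.
    by apply: differentiable_comp => //; exact: differentiable_coord.
  by rewrite derive_mx ?mxE//; exact: diff_derivable.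
have dp (F : V -> 'rV[R]_n) y : differentiable F y -> differentiable (p \o F) y.
  by move=> dF; apply: differentiable_comp => //; exact: differentiable_coord.
have dpd k : differentiable (fun y => 'd f y k) x ->
    is_diff x (fun y => 'd (p \o f) y k) ('d (p \o (fun y => 'd f y k)) x).
  move=> dk; apply: near_is_diff; last exact: dp.
  by apply: filterS df => y dy; rewrite /= -coordE.
have [dv' Ev] := dpd _ dv; have [dw' Ew] := dpd _ dw.
rewrite !coordE// -Ev -Ew; apply: schwarz_scalar => //.
by apply: filterS df => y; exact: dp.
Qed.

(** * Derivatives of row vectors and of moving linear maps *)

Lemma is_derive_rV (R : realType) p (f : R -> 'rV[R]_p) (t : R)
    (df : 'rV[R]_p) :
  (forall i, is_derive t 1 (fun t => f t ord0 i) (df ord0 i)) <->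
  is_derive t 1 f df.
Proof.
split=> [d|[dv fE] i].
  have dv : derivable f t 1.
    by apply/derivable_mxP => i j; rewrite ord1; have [] := d j.
  apply: DeriveDef => //; rewrite derive_mx//; apply/rowP => i.
  by rewrite mxE; have [] := d i.
apply: DeriveDef; first exact: (derivable_mxP _ _ _).1.
by rewrite -fE derive_mx// mxE.
Qed.

Lemma is_derive_linear (R : realType) n (W : normedModType R)
    (f : {linear 'rV[R]_n -> W}) (c : R -> 'rV[R]_n) (t : R) dc :
  is_derive t 1 c dc -> is_derive t 1 (f \o c) (f dc).
Proof.
have [df fE] := is_diff_rV_linear f (c t).
by move=> /(is_derive1_comp)/(_ df); rewrite fE.
Qed.

(** Concatenation becomes a sum of two linear maps, to which the rules for linear maps apply. *)
Lemma row_mx_split (R : realType) m n (u : 'rV[R]_m) (v : 'rV[R]_n) :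
  row_mx u v = u *m row_mx 1%:M 0 + v *m row_mx 0 1%:M.
Proof. by rewrite !mul_mx_row add_row_mx !mulmx1 !mulmx0 addr0 add0r. Qed.

Lemma is_derive_row_mx (R : realType) m n (c : R -> 'rV[R]_m)
    (z : R -> 'rV[R]_n) (t : R) dc dz :
  is_derive t 1 c dc -> is_derive t 1 z dz ->
  is_derive t 1 (fun t => row_mx (c t) (z t)) (row_mx dc dz).
Proof.
move=> /(is_derive_linear (mulmxr (row_mx 1%:M 0 : 'M[R]_(_, m + n)))) d1.
move=> /(is_derive_linear (mulmxr (row_mx 0 1%:M : 'M[R]_(_, m + n)))) d2.
have := is_deriveD d1 d2; rewrite /= -row_mx_split.
by congr is_derive; apply/funext => s; rewrite row_mx_split.
Qed.

Lemma is_diff_row_mx_r (R : realType) m n (e : 'rV[R]_m) (z : 'rV[R]_n) :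
  is_diff z (row_mx e) (row_mx 0).
Proof.
have := is_diffD (is_diff_cst (e *m row_mx 1%:M 0 : 'rV[R]_(m + n)) z)
  (is_diff_rV_linear (mulmxr (row_mx 0 1%:M : 'M[R]_(_, m + n))) z).
rewrite add0r.
have -> : cst (e *m row_mx 1%:M 0) + mulmxr (row_mx 0 1%:M) =
    row_mx e :> ('rV[R]_n -> _).
  by apply/funext => v; rewrite row_mx_split.
move=> [d dE]; apply: DiffDef => //; rewrite dE.
by apply/funext => v; rewrite /= row_mx_split mul0mx add0r.
Qed.

Lemma is_diff_comp_row_mx (R : realType) m n (W : normedModType R)
    (F : 'rV[R]_(m + n) -> W) (e : 'rV[R]_m) (z : 'rV[R]_n) :
  differentiable F (row_mx e z) ->
  is_diff z (F \o row_mx e) ('d F (row_mx e z) \o row_mx 0).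
Proof.
move=> dF; apply: is_diff_comp; first exact: is_diff_row_mx_r.
exact: differentiableP.
Qed.

(* Product rule for t |-> M_t (y_t) with M_t linear, where M is only known to be
   differentiable on the vectors of the canonical basis. *)
Lemma is_derive_apply_scalar (R : realType) n (M : R -> 'rV[R]_n -> R)
    (dM : 'rV[R]_n -> R) (y : R -> 'rV[R]_n) (t : R) dy :
  (forall s, scalar (M s)) -> scalar dM ->
  (forall i, is_derive t 1 (M ^~ (delta_mx 0 i)) (dM (delta_mx 0 i))) ->
  is_derive t 1 y dy ->
  is_derive t 1 (fun s => M s (y s)) (dM (y t) + M t dy).
Proof.
move=> Ml dMl dMi dyt.
have linE (f : 'rV[R]_n -> R) : scalar f ->
    forall v, f v = \sum_(i < n) v ord0 i * f (delta_mx 0 i).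
  move=> fl v; pose fM := GRing.isLinear.Build _ _ _ _ _ fl.
  pose fL : {linear 'rV[R]_n -> R | *%R} := HB.pack f fM.
  rewrite -[f]/(fL : _ -> _) {1}[v]row_sum_delta linear_sum.
  by apply: eq_bigr => i _; rewrite linearZ.
(* Expansion in the canonical basis leaves a finite sum of products of real functions. *)
have -> : (fun s => M s (y s)) =
    \sum_(i < n) (fun s => y s ord0 i * M s (delta_mx 0 i)).
  by apply/funext => s; rewrite fct_sumE -linE.
rewrite (linE _ dMl) (linE _ (Ml t)) -big_split /=.
apply: is_derive_sum => i.
have dyi := (is_derive_rV _ _ _).2 dyt i.
have := is_deriveM dyi (dMi i).
by rewrite /GRing.scale /= (mulrC _ (dy ord0 i)).
Qed.

Lemma is_derive_apply (R : realType) n p (M : R -> 'rV[R]_n -> 'rV[R]_p)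
    (dM : 'rV[R]_n -> 'rV[R]_p) (y : R -> 'rV[R]_n) (t : R) dy :
  (forall s, linear (M s)) -> linear dM ->
  (forall i, is_derive t 1 (M ^~ (delta_mx 0 i)) (dM (delta_mx 0 i))) ->
  is_derive t 1 y dy ->
  is_derive t 1 (fun s => M s (y s)) (dM (y t) + M t dy).
Proof.
move=> Ml dMl dMi dyt; apply/is_derive_rV => j; rewrite mxE.
apply: (@is_derive_apply_scalar _ _ (fun s v => M s v ord0 j)
  (fun v => dM v ord0 j)) => //.
- by move=> s a u v; rewrite Ml !mxE.
- by move=> a u v; rewrite dMl !mxE.
- by move=> i; exact: (is_derive_rV _ _ _).2 (dMi i) j.
Qed.

(** * Bilinearity of the metric *)

Lemma inner_scalarr (R : realType) n (M : topologicalType)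
    (g : M -> 'M[R]_n) x u :
  scalar (inner g x u).
Proof. by move=> a v w; rewrite /inner linearP /= mulmxDr -scalemxAr !mxE. Qed.

Lemma inner_scalarl (R : realType) n (M : topologicalType)
    (g : M -> 'M[R]_n) x v :
  scalar (fun u => inner g x u v).
Proof. by move=> a u w; rewrite /inner !mulmxDl -!scalemxAl !mxE. Qed.

(** * The smooth action read in charts *)

Section KillingFields.
Variables (R : realType) (m n : nat).
Variables (G : groupTopologicalType) (AG : atlas R m G).
Variables (M : topologicalType) (AM : atlas R n M).
Variables (act : G -> M -> M).
Hypotheses (hG : lie_group AG) (hM : smooth_manifold AM).
Hypothesis hact : smooth_action AG AM act.

(* This weakening of one_parameter_subgroup covers both values of exp_curve, so
   that the existence of one-parameter subgroups need not be proved. *)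
Definition one_parameter_curve (gamma : R -> G) : Prop :=
  [/\ forall s t, gamma (s + t) = (gamma s * gamma t)%g,
      {for 0, continuous gamma}
    & derivable (cmap (AG 1%g) \o gamma) 0 1].

(** For gamma equal to [exp_curve AG U] this is the fundamental field of U. *)
Definition flow_velocity (gamma : R -> G) : M -> 'rV[R]_n :=
  fun x => velocity AM (fun t => act (gamma t) x) 0.

Let e : 'rV[R]_m := cmap (AG 1%g) 1%g.

Lemma one_parameter_curve0 gamma : one_parameter_curve gamma ->
  gamma 0 = 1%g.
Proof.
move=> [homg _ _]; apply: (@mulgI _ (gamma 0)).
by rewrite mulg1 -homg addr0.
Qed.

Lemma chartG x : is_chart (AG x) /\ cdom (AG x) x.
Proof. by have [[_ _ H _] _ _] := hG; exact: H. Qed.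

Lemma chartM x : is_chart (AM x) /\ cdom (AM x) x.
Proof. by have [_ _ H _] := hM; exact: H. Qed.

Lemma cmapGK p x : cdom (AG p) x -> cinv (AG p) (cmap (AG p) x) = x.
Proof. by have [[_ _ H _ _] _] := chartG p; exact: H. Qed.

Lemma cmapMK p x : cdom (AM p) x -> cinv (AM p) (cmap (AM p) x) = x.
Proof. by have [[_ _ H _ _] _] := chartM p; exact: H. Qed.

Lemma act1 x : act 1%g x = x.
Proof. by have [_ H _] := hact; exact: H. Qed.

Lemma actM h k x : act (h * k)%g x = act h (act k x).
Proof. by have [_ _ H] := hact; exact: H. Qed.

Lemma act_continuous h x :
  {for (h, x), continuous (fun p : G * M => act p.1 p.2)}.
Proof. by have [[H _] _ _] := hact; exact: H. Qed.

Lemma one_parameter_curve_cst : one_parameter_curve (fun=> 1%g).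
Proof.
split=> [s t||]; first by rewrite mulg1.
- exact: cst_continuous.
- exact: derivable_cst.
Qed.

Lemma one_parameter_subgroup_curve gamma :
  one_parameter_subgroup AG gamma -> one_parameter_curve gamma.
Proof.
move=> [[cg sg] homg]; split=> //; first exact: cg.
have g0 : gamma 0 = 1%g.
  by apply: (@mulgI _ (gamma 0)); rewrite mulg1 -homg addr0.
(* Smoothness for [line_atlas] is stated over row vectors of length 1; composing with [const_mx]
   returns to a real variable. *)
have [/(_ (const_mx 0)) + _] := sg 0 1%g 1.
rewrite /= mxE g0 => d; apply/derivable1_diffP.
have {}d : differentiable (cmap (AG 1%g) \o gamma \o
    (fun z : 'rV[R]_1 => z ord0 ord0)) (const_mx 0).
  apply: d; split; first by exists 0.
  by have [] := chartG 1%g.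
have -> : cmap (AG 1%g) \o gamma = (cmap (AG 1%g) \o gamma \o
    (fun z : 'rV[R]_1 => z ord0 ord0)) \o (fun t : R => const_mx t).
  by apply/funext => t; rewrite /= mxE.
apply: differentiable_comp => //; apply/derivable1_diffP.
have [] // : is_derive (0 : R) 1 (fun t => const_mx t : 'rV[R]_1) (const_mx 1).
apply/is_derive_rV => i; rewrite mxE.
have -> : (fun t : R => (const_mx t : 'rV[R]_1) ord0 i) = id.
  by apply/funext => t; rewrite mxE.
exact: is_derive_id.
Qed.

Lemma killing_algebra_velocity X : killing_algebra AG AM act X ->
  exists2 gamma, one_parameter_curve gamma & X = flow_velocity gamma.
Proof.
move=> [U _ <-]; exists (exp_curve AG U) => //.
rewrite /exp_curve; case: xgetP => [gamma _ [g _]|_].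
- exact: one_parameter_subgroup_curve.
- exact: one_parameter_curve_cst.
Qed.

(* The action in the charts of G at 1 and of M at p and q. *)
Definition act_chart (p q : M) (w : 'rV[R]_(m + n)) : 'rV[R]_n :=
  cmap (AM q) (act (cinv (AG 1%g) (lsubmx w)) (cinv (AM p) (rsubmx w))).

Lemma act_chart_row_mx p q h x : cdom (AG 1%g) h -> cdom (AM p) x ->
  act_chart p q (row_mx (cmap (AG 1%g) h) (cmap (AM p) x)) =
  cmap (AM q) (act h x).
Proof.
by move=> hh hx; rewrite /act_chart row_mxKl row_mxKr cmapGK// cmapMK.
Qed.

(** The conclusion supplies the hypotheses of [schwarz], which is why smoothness of order 2 is
    extracted. It is available only on the set [S] below, and continuity of the charts and of the
    action makes [S] a neighbourhood of [w]. *)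
Lemma act_chart_smooth p q h x :
  cdom (AG 1%g) h -> cdom (AM p) x -> cdom (AM q) (act h x) ->
  let w := row_mx (cmap (AG 1%g) h) (cmap (AM p) x) in
  (\forall w' \near w, differentiable (act_chart p q) w') /\
  forall v, differentiable (fun w => 'd (act_chart p q) w v) w.
Proof.
move=> hh hx hhx w.
have [[_ sact] _ _] := hact.
set S := cimg (prod_atlas AG AM (1%g, p)) `&`
  ((fun p : G * M => act p.1 p.2) \o cinv (prod_atlas AG AM (1%g, p)))
    @^-1` cdom (AM q).
have [SC1 SC2] := sact (1%g, p) q 2%N.
suff Sn : nbhs w S.
  split; first exact: filterS Sn.
  by move=> v; have [d _] := SC2 v; exact: d (nbhs_singleton Sn).
have [[_ oG _ _ cG] _] := chartG 1%g; have [[_ oM _ _ cM] _] := chartM p.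
have [[oq _ _ _ _] _] := chartM q.
have wl : lsubmx w = cmap (AG 1%g) h by rewrite row_mxKl.
have wr : rsubmx w = cmap (AM p) x by rewrite row_mxKr.
have iG : cimg (AG 1%g) (lsubmx w) by rewrite wl; exists h.
have iM : cimg (AM p) (rsubmx w) by rewrite wr; exists x.
have cl : {for w, continuous (cinv (AG 1%g) \o lsubmx)}.
  by apply: continuous_comp; [exact: continuous_lsubmx|exact: cG].
have cr : {for w, continuous (cinv (AM p) \o rsubmx)}.
  by apply: continuous_comp; [exact: continuous_rsubmx|exact: cM].
have n1 : \forall w' \near w, cimg (AG 1%g) (lsubmx w').
  by apply: continuous_lsubmx; exact: open_nbhs_nbhs.
have n2 : \forall w' \near w, cimg (AM p) (rsubmx w').
  by apply: continuous_rsubmx; exact: open_nbhs_nbhs.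
have n3 : \forall w' \near w, cdom (AM q)
    (act (cinv (AG 1%g) (lsubmx w')) (cinv (AM p) (rsubmx w'))).
  have c3 := continuous2_cvg _ (act_continuous (h := cinv (AG 1%g) (lsubmx w))
    (x := cinv (AM p) (rsubmx w))) cl cr.
  apply: c3; apply: open_nbhs_nbhs; split => //.
  by rewrite wl wr cmapGK ?cmapMK.
near=> w'; split; last by near: w'; exact: n3.
have [h' hh' hE] : cimg (AG 1%g) (lsubmx w') by near: w'.
have [x' hx' xE] : cimg (AM p) (rsubmx w') by near: w'.
by exists (h', x') => //=; rewrite hE xE hsubmxK.
Unshelve. all: by end_near. Qed.

(** * Orbits and their velocity fields *)

Let rate (gamma : R -> G) : 'rV[R]_m := 'D_1 (cmap (AG 1%g) \o gamma) 0.

Lemma one_parameter_curve_near gamma : one_parameter_curve gamma ->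
  \forall t \near 0, cdom (AG 1%g) (gamma t).
Proof.
move=> hgamma; have [_ cgamma _] := hgamma.
have [[oG _ _ _ _] d1] := chartG 1%g.
by apply: cgamma; apply: open_nbhs_nbhs; rewrite one_parameter_curve0.
Qed.

Lemma orbit_continuous gamma x : one_parameter_curve gamma ->
  {for 0, continuous (fun t => act (gamma t) x)}.
Proof.
move=> [_ cgamma _].
exact: (continuous2_cvg _ (act_continuous (h := gamma 0) (x := x)) cgamma
  (cvg_cst x)).
Qed.

Lemma orbit_near gamma q x : one_parameter_curve gamma -> cdom (AM q) x ->
  \forall t \near 0, cdom (AM q) (act (gamma t) x).
Proof.
move=> hgamma qx; have c := orbit_continuous (x := x) hgamma.
apply: c; apply: open_nbhs_nbhs; rewrite one_parameter_curve0// act1.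
by split=> //; have [[]] := chartM q.
Qed.

Lemma is_derive_coord_curve gamma : one_parameter_curve gamma ->
  is_derive (0 : R) 1 (cmap (AG 1%g) \o gamma) (rate gamma).
Proof. by move=> [_ _ d]; exact: derivableP. Qed.

Lemma act_chart_smooth1 p q x : cdom (AM p) x -> cdom (AM q) x ->
  let w := row_mx e (cmap (AM p) x) in
  (\forall w' \near w, differentiable (act_chart p q) w') /\
  forall v, differentiable (fun w => 'd (act_chart p q) w v) w.
Proof.
move=> px qx; apply: act_chart_smooth => //; last by rewrite act1.
by have [] := chartG 1%g.
Qed.

(** While gamma(t) stays in the chart at 1, hence for t near 0, the orbit is [act_chart] along the
    curve (gamma(t), x), and the chain rule applies. *)
Lemma is_derive_orbit gamma p q x : one_parameter_curve gamma ->
  cdom (AM p) x -> cdom (AM q) x ->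
  is_derive (0 : R) 1 (fun t => cmap (AM q) (act (gamma t) x))
    ('d (act_chart p q) (row_mx e (cmap (AM p) x)) (row_mx (rate gamma) 0)).
Proof.
move=> hgamma px qx.
have [/nbhs_singleton da _] := act_chart_smooth1 px qx.
have dw := is_derive_row_mx (is_derive_coord_curve hgamma)
  (is_derive_cst (cmap (AM p) x) (0 : R) 1).
have w0 : row_mx ((cmap (AG 1%g) \o gamma) 0) (cst (cmap (AM p) x) (0 : R)) =
  row_mx e (cmap (AM p) x) by rewrite /= one_parameter_curve0.
have := is_derive1_comp dw; rewrite w0 => /(_ _ _ da).
apply: near_eq_is_derive.
near=> t; rewrite /= act_chart_row_mx//.
near: t; exact: one_parameter_curve_near.
Unshelve. all: by end_near. Qed.

Lemma flow_velocityE gamma p x : one_parameter_curve gamma ->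
  cdom (AM p) x ->
  flow_velocity gamma x =
  'd (act_chart p x) (row_mx e (cmap (AM p) x)) (row_mx (rate gamma) 0).
Proof.
move=> hgamma px; rewrite /flow_velocity /velocity one_parameter_curve0//.
rewrite act1 derive1E.
by have [_ <-] := is_derive_orbit hgamma px (chartM x).2.
Qed.

Lemma transition_differentiable p q x :
  cdom (AM p) x -> cdom (AM q) x ->
  differentiable (cmap (AM q) \o cinv (AM p)) (cmap (AM p) x).
Proof.
move=> px qx; have [_ _ _ /(_ p q 1%N)[H _]] := hM.
by apply: H; split; [exists x|rewrite /= cmapMK].
Qed.

(** The transition map carries the orbit read in the chart at x to the orbit read in the chart at p,
    hence also their derivatives. The field thus becomes a first partial derivative of
    [act_chart p p], which can be differentiated once more. *)
Lemma local_rep_flow_velocity gamma p x : one_parameter_curve gamma ->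
  cdom (AM p) x ->
  local_rep AM (flow_velocity gamma) p (cmap (AM p) x) =
  'd (act_chart p p) (row_mx e (cmap (AM p) x)) (row_mx (rate gamma) 0).
Proof.
move=> hgamma px; rewrite /local_rep cmapMK// /change_chart.
have xx := (chartM x).2.
have dx : is_derive (0 : R) 1 (fun t => cmap (AM x) (act (gamma t) x))
    (flow_velocity gamma x).
  by rewrite (flow_velocityE hgamma px); exact: is_derive_orbit.
have dt := transition_differentiable xx px.
have o0 : cmap (AM x) (act (gamma 0) x) = cmap (AM x) x.
  by rewrite one_parameter_curve0// act1.
have := is_derive1_comp dx; rewrite /= o0 => /(_ _ _ dt) dy.
have [_ <-] := is_derive_orbit hgamma px px.
have [_ <-] := dy.
apply: near_eq_derive.
near=> t; rewrite /= cmapMK//.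
near: t; exact: orbit_near.
Unshelve. all: by end_near. Qed.

Lemma is_derive_orbit_velocity gamma p : one_parameter_curve gamma ->
  is_derive (0 : R) 1 (fun t => cmap (AM p) (act (gamma t) p))
    (flow_velocity gamma p).
Proof.
move=> hgamma; have pp := (chartM p).2.
by rewrite (flow_velocityE hgamma pp); exact: is_derive_orbit.
Qed.

Lemma local_rep_center gamma p : one_parameter_curve gamma ->
  local_rep AM (flow_velocity gamma) p (cmap (AM p) p) = flow_velocity gamma p.
Proof.
move=> hgamma; have pp := (chartM p).2.
by rewrite (local_rep_flow_velocity hgamma pp) (flow_velocityE hgamma pp).
Qed.

(** * Differentials of the transformations of M, in a fixed chart *)

(** [dmap] uses the chart at x, which moves with x. Factoring through the chart at p puts the
    dependence on h and x into the base point of a differential of [act_chart]. *)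
Lemma dmap_act h x v p : cdom (AG 1%g) h -> cdom (AM p) x ->
  dmap AM AM (act h) x v =
  'd (act_chart p (act h x)) (row_mx (cmap (AG 1%g) h) (cmap (AM p) x))
    (row_mx 0 (change_chart AM x p x v)).
Proof.
move=> hh px; have xx := (chartM x).2; have hxx := (chartM (act h x)).2.
have [/nbhs_singleton da _] := act_chart_smooth hh px hxx.
have dt := transition_differentiable xx px.
have tx : (cmap (AM p) \o cinv (AM x)) (cmap (AM x) x) = cmap (AM p) x.
  by rewrite /= cmapMK.
have dc : is_diff ((cmap (AM p) \o cinv (AM x)) (cmap (AM x) x))
    (act_chart p (act h x) \o row_mx (cmap (AG 1%g) h))
    ('d (act_chart p (act h x)) (row_mx (cmap (AG 1%g) h) (cmap (AM p) x))
       \o row_mx 0).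
  by rewrite tx; exact: is_diff_comp_row_mx.
have [dF FE] := is_diff_comp (differentiableP dt) dc.
have [_ dE] : is_diff (cmap (AM x) x)
    (cmap (AM (act h x)) \o act h \o cinv (AM x))
    ('d ((act_chart p (act h x) \o row_mx (cmap (AG 1%g) h)) \o
       (cmap (AM p) \o cinv (AM x))) (cmap (AM x) x)).
  apply: near_is_diff => //.
  have [[_ _ _ _ cx] _] := chartM x; have [[op _ _ _ _] _] := chartM p.
  near=> z; rewrite /= act_chart_row_mx//.
  near: z; apply: (cx (cmap (AM x) x)); first by exists x.
  by apply: open_nbhs_nbhs; rewrite cmapMK.
exact: etrans (congr1 (@^~ v) dE) (congr1 (@^~ v) FE).
Unshelve. all: by end_near. Qed.

Lemma near_cimg p x (P : set 'rV[R]_n) : cdom (AM p) x ->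
  (forall x', cdom (AM p) x' -> P (cmap (AM p) x')) ->
  \forall z \near cmap (AM p) x, P z.
Proof.
move=> px HP; have [[_ op _ _ _] _] := chartM p.
have : nbhs (cmap (AM p) x) (cimg (AM p)).
  by apply: open_nbhs_nbhs; split=> //; exists x.
by apply: filterS => _ [x' px' <-]; exact: HP.
Qed.

(** Since 1 acts trivially, z |-> [act_chart p p (row_mx e z)] is the identity on the image of the
    chart. *)
Lemma diff_act_chart_r p x v : cdom (AM p) x ->
  'd (act_chart p p) (row_mx e (cmap (AM p) x)) (row_mx 0 v) = v.
Proof.
move=> px; have [/nbhs_singleton da _] := act_chart_smooth1 px px.
have [dc cE] := is_diff_comp_row_mx da.
have [_ idE] : is_diff (cmap (AM p) x) id
    ('d (act_chart p p \o row_mx e) (cmap (AM p) x)).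
  apply: near_is_diff => //; apply: near_cimg => // x' px' /=.
  by rewrite act_chart_row_mx ?act1//; exact: (chartG 1%g).2.
have [_ id1] := is_diff_id (cmap (AM p) x).
exact: etrans (esym (congr1 (@^~ v) (etrans idE cE))) (congr1 (@^~ v) id1).
Qed.

Lemma differentiable_local_rep gamma p : one_parameter_curve gamma ->
  differentiable (local_rep AM (flow_velocity gamma) p) (cmap (AM p) p).
Proof.
move=> hgamma; have pp := (chartM p).2.
have [_ /(_ (row_mx (rate gamma) 0)) ad] := act_chart_smooth1 pp pp.
have [d _] := is_diff_comp_row_mx ad.
have [] // : is_diff (cmap (AM p) p) (local_rep AM (flow_velocity gamma) p)
  ('d ((fun w => 'd (act_chart p p) w (row_mx (rate gamma) 0)) \o row_mx e)
     (cmap (AM p) p)).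
apply: near_is_diff => //; apply: near_cimg => // x px /=.
by rewrite local_rep_flow_velocity.
Qed.

(* Once the derivatives are exchanged by Schwarz's theorem, this is the term
   - DZ(Y) of [Z, Y] = DY(Z) - DZ(Y), Z being the velocity of gamma: at the
   points (e, z) the differential of the action maps (rate gamma, 0) to Z and
   (0, v) to v. *)
Lemma diff_act_chart_mixed gamma p v : one_parameter_curve gamma ->
  'd (fun w => 'd (act_chart p p) w
        (row_mx (- rate gamma) (flow_velocity gamma p)))
     (row_mx e (cmap (AM p) p)) (row_mx 0 v) =
  - 'd (local_rep AM (flow_velocity gamma) p) (cmap (AM p) p) v.
Proof.
move=> hgamma; have pp := (chartM p).2.
set k := row_mx (- _) _; have [_ /(_ k) ad] := act_chart_smooth1 pp pp.
have [_ cE] := is_diff_comp_row_mx ad.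
have dL := differentiableP (differentiable_local_rep p hgamma).
have [dS SE] :=
  is_diffB (is_diff_cst (flow_velocity gamma p) (cmap (AM p) p)) dL.
have [_ FE] : is_diff (cmap (AM p) p)
    ((fun w => 'd (act_chart p p) w k) \o row_mx e)
    ('d (cst (flow_velocity gamma p) - local_rep AM (flow_velocity gamma) p)
      (cmap (AM p) p)).
  apply: near_is_diff => //; apply: near_cimg => // x px.
  rewrite /= !fctE /= local_rep_flow_velocity//.
  (* Along the points (e, z), the two terms give Z(p), a constant, and Z(z); the map to
     differentiate is Z(p) - Z(z). *)
  have -> : k = row_mx 0 (flow_velocity gamma p) - row_mx (rate gamma) 0.
    by rewrite opp_row_mx add_row_mx sub0r subr0.
  by rewrite linearB /= diff_act_chart_r.
have := congr1 (@^~ v) (etrans (esym cE) (etrans FE SE)).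
by rewrite /= !fctE sub0r.
Qed.

(** * Pullback along a flow and its derivative *)

(* When gamma is a one-parameter curve, the values are components of tangent
   vectors at the fixed point p, by act_opp. *)
Definition pullback (gamma : R -> G) (Y : M -> 'rV[R]_n) (p : M) (t : R) :
    'rV[R]_n :=
  dmap AM AM (act (gamma (- t))) (act (gamma t) p) (Y (act (gamma t) p)).

Lemma act_opp gamma t x : one_parameter_curve gamma ->
  act (gamma (- t)) (act (gamma t) x) = x.
Proof.
move=> hgamma; have [homg _ _] := hgamma.
by rewrite -actM -homg addNr one_parameter_curve0// act1.
Qed.

Lemma pullback0 gamma Y p : one_parameter_curve gamma ->
  pullback gamma Y p 0 = Y p.
Proof.
move=> hgamma; have pp := (chartM p).2; have d1 := (chartG 1%g).2.
rewrite /pullback oppr0 one_parameter_curve0// act1.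
rewrite (dmap_act _ d1 pp) act1.
apply: etrans (diff_act_chart_r _ pp) _.
rewrite /change_chart.
have [_ idE] : is_diff (cmap (AM p) p) (cmap (AM p) \o cinv (AM p))
    ('d id (cmap (AM p) p)).
  apply: near_is_diff => //; apply: near_cimg => // x px /=.
  by rewrite cmapMK.
have [_ id1] := is_diff_id (cmap (AM p) p).
have E := etrans idE id1; have := congr1 (@^~ (Y p)) E.
by apply.
Qed.

(** Let Z and Y be the velocities of gamma and delta. Near t = 0 the pullback is a linear map P_t,
    the differential of the action at (gamma(-t), gamma(t) p), applied to the moving vector
    Y(gamma(t) p). By the product rule, the vector contributes DY(Z) and P_t contributes - DZ(Y). *)
Lemma is_derive_pullback gamma delta p :
  one_parameter_curve gamma -> one_parameter_curve delta ->
  is_derive (0 : R) 1 (pullback gamma (flow_velocity delta) p)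
    (lie_bracket AM (flow_velocity gamma) (flow_velocity delta) p).
Proof.
move=> hgamma hdelta; have pp := (chartM p).2.
have [an ad] := act_chart_smooth1 pp pp.
pose z t := cmap (AM p) (act (gamma t) p).
have dz : is_derive (0 : R) 1 z (flow_velocity gamma p).
  exact: is_derive_orbit_velocity.
have z0 : z 0 = cmap (AM p) p by rewrite /z one_parameter_curve0// act1.
pose c t := cmap (AG 1%g) (gamma (- t)).
have dc : is_derive (0 : R) 1 c (- rate gamma).
  have [dg gE] := is_derive_coord_curve hgamma.
  have dg' : differentiable (cmap (AG 1%g) \o gamma) (- (0 : R)).
    by rewrite oppr0; exact/derivable1_diffP.
  apply: is_derive_eq (is_derive1_comp (is_deriveNid (0 : R) 1) dg') _.
  rewrite oppr0 in dg' *.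
  by rewrite (linearN ('d (cmap (AG 1%g) \o gamma) 0)) -(deriveE _ dg').
pose Q t := row_mx (c t) (z t).
pose k := row_mx (- rate gamma) (flow_velocity gamma p).
have dQ : is_derive (0 : R) 1 Q k by exact: is_derive_row_mx.
have Q0 : Q 0 = row_mx e (cmap (AM p) p).
  by rewrite /Q z0 /c oppr0 one_parameter_curve0.
pose L := local_rep AM (flow_velocity delta) p.
have dLz : is_derive (0 : R) 1 (L \o z)
    ('d L (cmap (AM p) p) (flow_velocity gamma p)).
  rewrite -z0; apply: is_derive1_comp => //; rewrite z0.
  exact: differentiable_local_rep.
(* The chain rule along [Q] differentiates first along (0, v), then along k. The opposite order is
   taken here, to suit [diff_act_chart_mixed]; Schwarz's theorem exchanges the two in [dPi]. *)
pose dM v := 'd (fun w => 'd (act_chart p p) w k) (row_mx e (cmap (AM p) p))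
  (row_mx 0 v : 'rV[R]_(m + n)).
pose P t v := 'd (act_chart p p) (Q t) (row_mx 0 v : 'rV[R]_(m + n)).
have row0_linear : linear (row_mx 0 : 'rV[R]_n -> 'rV[R]_(m + n)).
  by move=> s u v; rewrite scale_row_mx scaler0 add_row_mx addr0.
have Pl t : linear (P t) by move=> s u v; rewrite /P row0_linear linearP.
have dMl : linear dM.
  move=> s u v; rewrite /dM row0_linear.
  exact: (linearP ('d (fun w => 'd (act_chart p p) w k) (row_mx e _))).
have dPi (i : 'I_n) :
    is_derive (0 : R) 1 (P ^~ (delta_mx 0 i)) (dM (delta_mx 0 i)).
  rewrite /dM -(schwarz an (ad _) (ad _)) -Q0.
  by apply: is_derive1_comp => //; rewrite Q0; exact: ad.
have := is_derive_apply Pl dMl dPi dLz.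
have -> : dM ((L \o z) 0) + P 0 ('d L (cmap (AM p) p) (flow_velocity gamma p)) =
    lie_bracket AM (flow_velocity gamma) (flow_velocity delta) p.
  rewrite /P Q0 diff_act_chart_r// /dM diff_act_chart_mixed//.
  by rewrite /= z0 /L local_rep_center// addrC.
apply: near_eq_is_derive.
have n1 : \forall t \near (0 : R), cdom (AG 1%g) (gamma (- t)).
  have := one_parameter_curve_near hgamma.
  by rewrite -{1}oppr0; exact: opp_continuous.
near=> t.
have dt : cdom (AG 1%g) (gamma (- t)) by near: t.
have pt : cdom (AM p) (act (gamma t) p) by near: t; exact: orbit_near.
have LE : L (z t) = change_chart AM (act (gamma t) p) p (act (gamma t) p)
    (flow_velocity delta (act (gamma t) p)) by rewrite /L /local_rep /z cmapMK.
(* The point gamma(-t) gamma(t) p is p, so the target chart is the chart at p for every t. *)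
rewrite /P /= LE; apply: etrans (esym (dmap_act _ dt pt)).
by rewrite act_opp.
Unshelve. all: by end_near. Qed.

(** The metric itself is never differentiated: after pulling back to p, only the fixed bilinear form
    g_p occurs. *)
Lemma inner_bracket (g : M -> 'M[R]_n) gamma delta eta c p :
  (forall h, preserves_metric AM g (act h)) ->
  one_parameter_curve gamma -> one_parameter_curve delta ->
  one_parameter_curve eta ->
  (forall x, inner g x (flow_velocity delta x) (flow_velocity eta x) = c) ->
  inner g p (lie_bracket AM (flow_velocity gamma) (flow_velocity delta) p)
    (flow_velocity eta p) +
  inner g p (flow_velocity delta p)
    (lie_bracket AM (flow_velocity gamma) (flow_velocity eta) p) = 0.
Proof.
move=> hiso hgamma hdelta heta cE.
have dY := is_derive_pullback p hgamma hdelta.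
have dX := is_derive_pullback p hgamma heta.
set DY := lie_bracket _ _ _ p in dY *.
set DX := lie_bracket _ _ _ p in dX *.
(* The product rule is used twice: here with the constant linear form g_p(v, .), then in [dB] with
   the moving linear form g_p(., W_t), W being the velocity of eta. *)
have dl v : is_derive (0 : R) 1
    (fun t => inner g p v (pullback gamma (flow_velocity eta) p t))
    (inner g p v DX).
  have s0 : scalar (fun _ : 'rV[R]_n => 0 : R).
    by move=> a u w; rewrite mulr0 addr0.
  have := is_derive_apply_scalar (fun=> @inner_scalarr _ _ _ g p v) s0
    (fun i => is_derive_cst _ _ _) dX.
  by rewrite add0r.
have dB := is_derive_apply_scalar
  (fun t => @inner_scalarl _ _ _ g p (pullback gamma (flow_velocity eta) p t))
  (@inner_scalarl _ _ _ g p DX) (fun i => dl _) dY.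
have [_] := dB; rewrite !pullback0// addrC => <-.
rewrite -[RHS](derive_cst c (0 : R) 1); apply: near_eq_derive.
(* The isometry given by gamma(-t) carries the constant product at gamma(t) p to the product of the
   pullbacks at p. *)
near=> t; rewrite /cst -(cE (act (gamma t) p)) -[RHS](hiso (gamma (- t))).
by rewrite /pullback act_opp.
Unshelve. all: by end_near. Qed.

End KillingFields.

(** * Eigenvalues of ad(X) *)

Theorem theorem1 (R : realType) (m n : nat)
    (G : groupTopologicalType) (AG : atlas R m G)
    (M : topologicalType) (AM : atlas R n M) (g : M -> 'M[R]_n)
    (act : G -> M -> M)
    (hG : lie_group AG)
    (hM : smooth_manifold AM) (Mconnected : connected [set: M])
    (hg : riemannian_metric AM g)
    (hact : smooth_action AG AM act) (heff : effective act)
    (hiso : forall h : G, preserves_metric AM g (act h))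
    (X : M -> 'rV[R]_n) (hX : killing_algebra AG AM act X)
    (hlen : constant_length g X) :
  spectrum (killing_algebra AG AM act) (lie_bracket AM X)
    `<=` [set z : R[i] | complex.Re z = 0].
Proof.
move=> z [[U V] /= [hU hV w0 eig]].
have [gsym gpos _] := hg; have [c cX] := hlen.
(* These are the real and imaginary parts of [X, U + iV] = z (U + iV). *)
have {}eig : lie_bracket AM X U = complex.Re z *: U - complex.Im z *: V /\
    lie_bracket AM X V = complex.Re z *: V + complex.Im z *: U by case: eig.
move: (complex.Re z) (complex.Im z) eig => a b [eigU eigV].
have bracketC (Y Z : M -> 'rV[R]_n) x :
    lie_bracket AM Y Z x = - lie_bracket AM Z Y x.
  by rewrite /lie_bracket opprB.
have killing Z Y W k : killing_algebra AG AM act Z ->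
    killing_algebra AG AM act Y -> killing_algebra AG AM act W ->
    (forall x, inner g x (Y x) (W x) = k) ->
    forall x, inner g x (lie_bracket AM Z Y x) (W x) +
      inner g x (Y x) (lie_bracket AM Z W x) = 0.
  move=> /(killing_algebra_velocity hG)[gamma hgamma ->].
  move=> /(killing_algebra_velocity hG)[delta hdelta ->].
  move=> /(killing_algebra_velocity hG)[eta heta ->] H x.
  exact: (inner_bracket hG hM hact x hiso hgamma hdelta heta H).
have innerN x u v : inner g x u (- v) = - inner g x u v.
  by rewrite /inner linearN /= mulmxN mxE.
have innerZ x u k v : inner g x u (k *: v) = k * inner g x u v.
  by rewrite /inner linearZ /= -scalemxAr mxE.
have innerD x u v w : inner g x u (v + w) = inner g x u v + inner g x u w.
  by rewrite /inner linearD /= mulmxDr mxE.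
have orthoX Y x : killing_algebra AG AM act Y ->
    inner g x (X x) (lie_bracket AM X Y x) = 0.
  move=> hY; have := killing _ _ _ _ hY hX hX cX x.
  rewrite gsym (bracketC Y X) innerN -opprD => /eqP.
  by rewrite oppr_eq0 -mulr2n mulrn_eq0 /= => /eqP.
have [-> //|a0] := eqVneq a 0.
have orthoUV x : inner g x (U x) (X x) = 0 /\ inner g x (V x) (X x) = 0.
  have := orthoX _ x hU; have := orthoX _ x hV.
  rewrite eigU eigV !fctE !(innerD, innerN, innerZ).
  rewrite (gsym x (U x) (X x)) (gsym x (V x) (X x)).
  set s := inner g x (X x) (U x); set t := inner g x (X x) (V x) => eV eU.
  have ab0 : a ^+ 2 + b ^+ 2 != 0.
    by rewrite gt_eqF// ltr_pwDl ?sqr_ge0// exprn_even_gt0.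
  (* Cramer's rule for a s - b t = 0 and b s + a t = 0. *)
  split; apply: (mulfI ab0); rewrite mulr0.
  - have -> : (a ^+ 2 + b ^+ 2) * s =
      a * (a * s - b * t) + b * (a * t + b * s) by ring.
    by rewrite eU eV !mulr0 addr0.
  - have -> : (a ^+ 2 + b ^+ 2) * t =
      a * (a * t + b * s) - b * (a * s - b * t) by ring.
    by rewrite eU eV !mulr0 subr0.
have self Y x : killing_algebra AG AM act Y ->
    (forall x, inner g x (Y x) (X x) = 0) ->
    inner g x (Y x) (lie_bracket AM X Y x) = 0.
  move=> hY YX; have := killing _ _ _ _ hY hY hX YX x.
  rewrite (bracketC Y X) innerN /lie_bracket subrr.
  by rewrite {1}/inner !mul0mx mxE add0r => /eqP; rewrite oppr_eq0 => /eqP.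
case: w0.
have UV0 x : U x = 0 /\ V x = 0.
  have := self _ x hU (fun x => (orthoUV x).1).
  have := self _ x hV (fun x => (orthoUV x).2).
  rewrite eigU eigV !fctE !(innerD, innerN, innerZ) (gsym x (V x) (U x)).
  set u := inner g x (U x) (U x); set v := inner g x (V x) (V x) => eV eU.
  have inner_ge0 (w : 'rV[R]_n) : 0 <= inner g x w w.
    have [->|/gpos/ltW //] := eqVneq w 0.
    by rewrite /inner trmx0 mulmx0 mxE.
  have inner_eq0 (w : 'rV[R]_n) : inner g x w w = 0 -> w = 0.
    by have [//|/(gpos x) w0 w0'] := eqVneq w 0; rewrite w0' ltxx in w0.
  (* The cross terms in g(U, V) have opposite signs and cancel in the sum. *)
  have /eqP : a * (u + v) = 0.
    have -> : a * (u + v) = (a * u - b * inner g x (U x) (V x)) +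
      (a * v + b * inner g x (U x) (V x)) by ring.
    by rewrite eU eV addr0.
  rewrite mulf_eq0 (negPf a0) paddr_eq0 ?inner_ge0//= => /andP[/eqP u0 /eqP v0].
  by split; exact: inner_eq0.
by congr pair; apply/funext => x; have [] := UV0 x.
Qed.
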